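(* Let $c\ge1$ and $t\ge2$, and let $(G,N)$ be a pair of finite groups that is nilpotent of class at most $t$. Then: (i) $\displaystyle |[N,\,_cG]|\,|M^{(c)}(G,N)|$ divides $\displaystyle \left|M^{(c)}\!\left(\frac{G}{[N,G]},\frac{N}{[N,G]}\right)\right|\prod_{i=1}^{t-1}\left|\otimes^{c+1}\!\left([N,\,_iG],\frac{G}{[N,\,_iG]}\right)\right|$; (ii) $\displaystyle d(M^{(c)}(G,N))\le d\!\left(M^{(c)}\!\left(\frac{G}{[N,G]},\frac{N}{[N,G]}\right)\right)+\sum_{i=1}^{t-1}d\!\left(\otimes^{c+1}\!\left([N,\,_iG],\frac{G}{[N,\,_iG]}\right)\right)$; (iii) $\displaystyle \exp(M^{(c)}(G,N))$ divides $\displaystyle \exp\!\left(M^{(c)}\!\left(\frac{G}{[N,G]},\frac{N}{[N,G]}\right)\right)\prod_{i=1}^{t-1}\exp\!\left(\otimes^{c+1}\!\left([N,\,_iG],\frac{G}{[N,\,_iG]}\right)\right)$.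
   Context: A pair of groups $(G,N)$ is a group $G$ with a normal subgroup $N$. Commutators are left-normed: $[X,\,_0F]=X$ and $[X,\,_{k+1}F]=[[X,\,_kF],F]$. For a pair $(G,N)$ and $c\ge1$, take a free presentation $1\to R\to F\to G\to 1$ ($F$ free) and let $S\le F$ be the preimage of $N$, so that $N\cong S/R$. The $c$-nilpotent multiplier of the pair is $$M^{(c)}(G,N)=\frac{R\cap[S,\,_cF]}{[R,\,_cF]}.$$ The pair $(G,N)$ is nilpotent of class at most $t$ if $[N,\,_tG]=1$. $\otimes^{c+1}(B,Q)=B\otimes Q\otimes\cdots\otimes Q$ with $c$ copies of $Q$, where the tensor product of groups is the tensor product over $\mathbf{Z}$ of their abelianizations. $d(X)$ is the minimal number of generators of the group $X$ and $\exp(X)$ is its exponent. *)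

(* Defs.v *)
From HB Require Import structures.
From mathcomp Require Import all_boot all_algebra all_fingroup finmap.
From mathcomp Require Import boolp classical_sets functions cardinality.
From mathcomp Require Import generic_quotient freeg.

Set Implicit Arguments.
Unset Strict Implicit.
Unset Printing Implicit Defensive.

Local Open Scope classical_set_scope.
Local Open Scope group_scope.

Section Subgroups.
Variable F : groupType.
Implicit Types A X Y : set F.

Definition subgroup A : Prop := A 1 /\ forall x y, A x -> A y -> A (x * y^-1).

Definition normal_subgroup A : Prop :=
  subgroup A /\ forall x y, A x -> A (x ^ y).

Definition subgroup_generated X : set F := smallest subgroup X.

Definition normal_closure X : set F := smallest normal_subgroup X.

Definition commutator_subgroup X Y : set F :=
  subgroup_generated [set z | exists x y, [/\ X x, Y y & z = [~ x, y]]].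

Definition iter_commutator c X Y : set F :=
  iter c (fun Z => commutator_subgroup Z Y) X.

Lemma normal_closure_normal X : normal_subgroup (normal_closure X).
Proof.
split; first split.
- by move=> A [[[]]].
- by move=> x y Ax Ay A nA; have [[[_ B] _] _] := nA; apply: B; [exact: Ax|exact: Ay].
- by move=> x y Ax A nA; have [[_ B] _] := nA; apply: B; exact: Ax.
Qed.

Lemma normal_subgroupT : normal_subgroup [set: F].
Proof. by []. Qed.

Lemma normal_subgroup_commutator X :
  normal_subgroup X -> normal_subgroup (commutator_subgroup X setT).
Proof.
move=> [_ nX]; split; first split.
- by move=> A [[]].
- by move=> x y Ax Ay A sA; have [[_ B] _] := sA; apply: B; [exact: Ax|exact: Ay].
move=> x y Ax A [[A1 AM] sXA].
pose B : set F := [set z | A (z ^ y)].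
suff: B x by [].
apply: Ax; split; first split.
- by rewrite /B /= conj1g.
- by move=> u v Bu Bv; rewrite /B /= conjMg conjVg; exact: AM.
move=> _ [u [v [Xu _ ->]]]; rewrite /B /= conjRg; apply: sXA.
by exists (u ^ y), (v ^ y); split => //; exact: nX.
Qed.

Lemma normal_subgroup_iter c X :
  normal_subgroup X -> normal_subgroup (iter_commutator c X setT).
Proof.
by move=> nX; elim: c => // c; exact: normal_subgroup_commutator.
Qed.

End Subgroups.

Arguments normal_subgroupT F : clear implicits.

Lemma normal_subgroup_ker (F H : groupType) (f : {multiplicative F -> H}) :
  normal_subgroup (f @^-1` [set 1]).
Proof.
have f1 : f 1 = 1 by apply: (mulgI (f 1)); rewrite -gmulfM !mulg1.
have fV x : f x^-1 = (f x)^-1 by apply: (mulgI (f x)); rewrite -gmulfM !mulgV.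
split; first split => //=.
- by move=> x y /= fx fy; rewrite gmulfM fV fx fy invg1 mulg1.
- by move=> x y /= fx; rewrite /conjg !gmulfM fV fx mul1g mulVg.
Qed.

Section Quotient.
Variables (F : groupType) (H : set F) (nH : normal_subgroup H).

Definition eqv_mod (x y : F) : bool := `[< H (x^-1 * y) >].

Let H1 : H 1. Proof. by case: nH => -[]. Qed.
Let HV x : H x -> H x^-1.
Proof. by case: nH => -[_ HB] _ Hx; rewrite -[x^-1]mul1g; exact: HB. Qed.
Let HM x y : H x -> H y -> H (x * y).
Proof. by case: nH => -[_ HB] _ Hx /HV Hy; rewrite -[y]invgK; exact: HB. Qed.
Let HJ x y : H x -> H (x ^ y).
Proof. by case: nH => _; exact. Qed.

Let eqv_refl : reflexive eqv_mod.
Proof. by move=> x; apply/asboolP; rewrite mulVg. Qed.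
Let eqv_sym : symmetric eqv_mod.
Proof.
by move=> x y; apply/asboolP/asboolP => /HV; rewrite invgM invgK.
Qed.
Let eqv_trans : transitive eqv_mod.
Proof.
move=> y x z /asboolP Hxy /asboolP Hyz; apply/asboolP.
by have := HM Hxy Hyz; rewrite mulgA mulgK.
Qed.

Local Canonical eqv_mod_equiv := EquivRel eqv_mod eqv_refl eqv_sym eqv_trans.

Definition quot_group : Type := {eq_quot eqv_mod}%qT.
HB.instance Definition _ := Choice.on quot_group.

Definition quot_pi (x : F) : quot_group := (\pi_{eq_quot eqv_mod} x)%qT.

Let qmul (a b : quot_group) := quot_pi (repr a * repr b).
Let qinv (a : quot_group) := quot_pi (repr a)^-1.

Lemma quot_piP x y : quot_pi x = quot_pi y <-> H (x^-1 * y).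
Proof.
split=> [/eqP|Hxy]; first by rewrite /quot_pi pi_eq_quot => /asboolP.
by apply/eqP; rewrite /quot_pi pi_eq_quot; apply/asboolP.
Qed.

Let piK a : quot_pi (repr a) = a. Proof. exact: reprK. Qed.
Let reprH x : H (x^-1 * repr (quot_pi x)).
Proof. by apply/quot_piP; rewrite piK. Qed.

Let qmulE x y : qmul (quot_pi x) (quot_pi y) = quot_pi (x * y).
Proof.
apply/esym/quot_piP; set x' := repr _; set y' := repr _.
have -> : (x * y)^-1 * (x' * y') = (x^-1 * x') ^ y * (y^-1 * y').
  by rewrite /conjg invgM !mulgA mulgK.
by apply: HM; [apply: HJ|]; exact: reprH.
Qed.
Let qinvE x : qinv (quot_pi x) = quot_pi x^-1.
Proof.
apply/quot_piP; rewrite invgK; set x' := repr _.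
have -> : x' * x^-1 = (x^-1 * x') ^ x^-1 by rewrite /conjg invgK !mulgA mulgV mul1g.
exact/HJ/reprH.
Qed.

Let qmulA : associative qmul.
Proof. by move=> a b c; rewrite -(piK a) -(piK b) -(piK c) !qmulE mulgA. Qed.
Let qmul1g : left_id (quot_pi 1) qmul.
Proof. by move=> a; rewrite -(piK a) qmulE mul1g. Qed.
Let qmulg1 : right_id (quot_pi 1) qmul.
Proof. by move=> a; rewrite -(piK a) qmulE mulg1. Qed.
Let qmulVg : left_inverse (quot_pi 1) qinv qmul.
Proof. by move=> a; rewrite -(piK a) qinvE qmulE mulVg. Qed.
Let qmulgV : right_inverse (quot_pi 1) qinv qmul.
Proof. by move=> a; rewrite -(piK a) qinvE qmulE mulgV. Qed.

HB.instance Definition _ :=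
  isGroup.Build quot_group qmulA qmul1g qmulg1 qmulVg qmulgV.

Let quot_piM : {morph quot_pi : x y / x * y}.
Proof. by move=> x y; rewrite -[RHS]/(qmul _ _) qmulE. Qed.

HB.instance Definition _ := isMultiplicative.Build _ _ quot_pi quot_piM.

End Quotient.

Section Invariants.
Variables (F : groupType) (A : set F).

(* Junk value: 0 when [P] is empty. *)
Definition least (P : set nat) : nat :=
  xget 0%N [set n | P n /\ forall m, P m -> (n <= m)%N].

(* The next three are 0 if [A] is respectively infinite, not finitely
   generated, or of unbounded exponent; otherwise they are the usual values. *)
Definition group_order : nat := #|` fset_set A|.

Definition min_generators : nat :=
  least [set n | exists s : n.-tuple F, subgroup_generated [set` s] = A].

Definition group_exponent : nat :=
  least [set n | (0 < n)%N /\ forall x, A x -> x ^+ n = 1].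

End Invariants.

Definition free_group (F : groupType) : Prop :=
  exists (X : Type) (b : X -> F), forall (H : groupType) (f : X -> H),
    (exists phi : {multiplicative F -> H}, forall x, phi (b x) = f x) /\
    (forall phi psi : {multiplicative F -> H},
       (forall x, phi (b x) = psi (b x)) -> phi =1 psi).

Definition free_presentation (F : groupType) (gT : finGroupType)
    (p : {multiplicative F -> gT}) (G : {group gT}) : Prop :=
  free_group F /\ range p = [set` G].

Section Multiplier.
Variables (c : nat) (F : groupType) (gT : finGroupType).
Variables (p : {multiplicative F -> gT}) (N : {group gT}).

Let R : set F := p @^-1` [set 1].
Let S : set F := p @^-1` [set` N].

Definition multiplier_ambient : groupType :=
  quot_group (normal_subgroup_iter c (normal_subgroup_ker p)).

(* The subgroup (R :&: [S, _c F]) / [R, _c F] of F / [R, _c F], where R is the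
   kernel of the presentation and S the preimage of N. *)
Definition multiplier : set multiplier_ambient :=
  quot_pi _ @` (R `&` iter_commutator c S setT).

End Multiplier.

Arguments multiplier c [F gT] p N.

Definition abelianization (A : groupType) : groupType :=
  quot_group (normal_subgroup_commutator (normal_subgroupT A)).

(* The additive group [V], written multiplicatively. *)
Definition multiplicative_of (V : zmodType) : Type := V.
HB.instance Definition _ (V : zmodType) := Choice.on (multiplicative_of V).
HB.instance Definition _ (V : zmodType) :=
  isGroup.Build (multiplicative_of V) (@GRing.addrA V) (@GRing.add0r V)
    (@GRing.addr0 V) (@GRing.addNr V) (@GRing.addrN V).

(* The tensor product over Z of the abelianizations of A and B: the free abelian
   group on pairs, modulo bilinearity, written multiplicatively. *)
Section Tensor.
Variables A B : groupType.

Definition free_abelian : groupType :=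
  multiplicative_of {freeg (abelianization A * abelianization B) / int}.

Definition free_tensor (a : abelianization A) (b : abelianization B) :
    free_abelian := [freeg [:: (1%R : int, (a, b))]].

Definition bilinear_relations : set free_abelian :=
  [set r | (exists a a' b, r = (free_tensor (a * a') b)^-1 *
                               (free_tensor a b * free_tensor a' b)) \/
           (exists a b b', r = (free_tensor a (b * b'))^-1 *
                               (free_tensor a b * free_tensor a b'))].

Definition tensor : groupType :=
  quot_group (normal_closure_normal bilinear_relations).

End Tensor.

(* [tensor_power c B Q] is B (x) Q (x) ... (x) Q with [c] factors [Q],
   associated to the left; the case [c = 0] is not used. *)
Definition tensor_power (c : nat) (B Q : groupType) : groupType :=
  iter c (fun T => tensor T Q) B.

Definition iter_comm (gT : finGroupType) (i : nat) (N G : {group gT}) :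
    {group gT} :=
  iter i (fun H : {group gT} => [~: H, G]%G) N.

(* Main.v *)
(** Let S_i be the preimage in F of [N, _i G] and V_i = [S_i, _c F], so that
    S_t is the kernel R and V_t = [R, _c F].  For 1 <= i < t we have
    S_i <= F' S_(i+1), and [S_i, F] <= S_(i+1); hence the iterated commutator
    [x, f_1, ..., f_c] modulo V_(i+1), with x in S_i, is multilinear, depends
    on x only modulo S_(i+1) and on the f_j only modulo F' S_i, and so induces a
    homomorphism from the tensor product of [N, _i G] and c copies of
    G / [N, _i G] onto V_i / V_(i+1).  The section V_0 / V_1 is a copy of the
    multiplier of (G / [N, G], N / [N, G]).  Finally M = (R \cap V_0) / V_t, and
    V_0 / (R \cap V_0) is isomorphic to [N, _c G]; the three bounds follow from
    the filtration (V_i) of V_0, whose sections are abelian. *)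
Require Import Defs.
From mathcomp Require Import all_boot all_algebra all_fingroup commutator finmap.
From HB Require Import structures.
From mathcomp Require Import boolp classical_sets cardinality.
From mathcomp Require Import generic_quotient freeg.

Set Implicit Arguments.
Unset Strict Implicit.
Unset Printing Implicit Defensive.

Local Open Scope classical_set_scope.
Local Open Scope group_scope.

(** * Homomorphisms, commutators and subgroups *)

(** Maps built in the middle of a proof become bundled morphisms through this lemma. *)
Lemma multiplicative_ex (G H : groupType) (f : G -> H) :
  {morph f : x y / x * y} -> exists g : {multiplicative G -> H}, g =1 f.
Proof.
move=> fM; pose m := isMultiplicative.Build G H f fM.
by exists (HB.pack_for {multiplicative G -> H} f m).
Qed.

Section Morphisms.
Variables (G H : groupType) (f : {multiplicative G -> H}).

Lemma gmorph1 : f 1 = 1.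
Proof. by apply: (mulgI (f 1)); rewrite -gmulfM !mulg1. Qed.

Lemma gmorphV x : f x^-1 = (f x)^-1.
Proof. by apply: (mulgI (f x)); rewrite -gmulfM !mulgV gmorph1. Qed.

Lemma gmorphX n x : f (x ^+ n) = f x ^+ n.
Proof. by elim: n => [|n IH]; rewrite ?gmorph1 // !expgS gmulfM IH. Qed.

Lemma gmorphR x y : f [~ x, y] = [~ f x, f y].
Proof. by rewrite /commg /conjg !gmulfM !gmorphV. Qed.

End Morphisms.

Section Commutators.
Variable F : groupType.
Implicit Types x y z : F.

Lemma commMg x y z : [~ x * y, z] = [~ x, z] ^ y * [~ y, z].
Proof. by rewrite !commgEr conjgM mulgA -conjMg mulgK. Qed.

Lemma commgM x y z : [~ x, y * z] = [~ x, z] * [~ x, y] ^ z.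
Proof. by rewrite !commgEl conjgM -mulgA -conjMg mulKVg. Qed.

Lemma hall_witt x y z :
  [~ x, y^-1, z] ^ y * [~ y, z^-1, x] ^ z * [~ z, x^-1, y] ^ x = 1.
Proof.
rewrite /commg /conjg !invgM !invgK !mulgA.
by rewrite !(mulgK, mulgVK) mulVg.
Qed.

End Commutators.

Section SubgroupTheory.
Variable F : groupType.
Implicit Types A B X Y : set F.

Lemma subgroupV A x : subgroup A -> A x -> A x^-1.
Proof. by case=> A1 AB Ax; rewrite -[x^-1]mul1g; exact: AB. Qed.

Lemma subgroupM A x y : subgroup A -> A x -> A y -> A (x * y).
Proof.
by move=> sA Ax /(subgroupV sA) Ay; rewrite -[y]invgK; case: sA => _; exact.
Qed.

Lemma subgroupX A n x : subgroup A -> A x -> A (x ^+ n).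
Proof.
move=> sA Ax; elim: n => [|n IH]; first by case: sA.
by rewrite expgS; exact: subgroupM.
Qed.

Lemma subgroupMr A x y : subgroup A -> A y -> A (x * y) -> A x.
Proof. by case=> _ AB Ay /AB /(_ Ay); rewrite mulgK. Qed.

Lemma subgroupI A B : subgroup A -> subgroup B -> subgroup (A `&` B).
Proof.
move=> [A1 AB] [B1 BB]; split=> // x y [Ax Bx] [Ay By].
by split; [exact: AB|exact: BB].
Qed.

Lemma normal_subgroupR A x y : normal_subgroup A -> A x -> A [~ x, y].
Proof.
move=> [sA nA] Ax; rewrite commgEl; apply: subgroupM => //.
  exact: subgroupV.
exact: nA.
Qed.

Lemma subgroup_generated_subgroup X : subgroup (subgroup_generated X).
Proof.
split=> [A [[]]//|x y Xx Xy A [sA XA]].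
by case: (sA) => _; apply; [exact: Xx|exact: Xy].
Qed.

Lemma sub_subgroup_generated X : X `<=` subgroup_generated X.
Proof. by move=> x Xx A [_]; exact. Qed.

Lemma subgroup_generated_min X A :
  subgroup A -> X `<=` A -> subgroup_generated X `<=` A.
Proof. by move=> sA XA x; exact. Qed.

Lemma mem_commutator X Y x y : X x -> Y y -> commutator_subgroup X Y [~ x, y].
Proof.
by move=> Xx Yy; apply: sub_subgroup_generated; exists x, y.
Qed.

Lemma commutator_min X Y A : subgroup A ->
  (forall x y, X x -> Y y -> A [~ x, y]) -> commutator_subgroup X Y `<=` A.
Proof.
move=> sA XYA; apply: subgroup_generated_min => // _ [x [y [Xx Yy ->]]].
exact: XYA.
Qed.

Lemma commutatorSl X Y Z : X `<=` Y ->
  commutator_subgroup X Z `<=` commutator_subgroup Y Z.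
Proof.
move=> XY; apply: commutator_min; first exact: subgroup_generated_subgroup.
by move=> x z /XY Yx Zz; exact: mem_commutator.
Qed.

Lemma iter_commutatorS c X Y Z : X `<=` Y ->
  iter_commutator c X Z `<=` iter_commutator c Y Z.
Proof. by move=> XY; elim: c => //= c IH; exact: commutatorSl. Qed.

(** The definition puts the newest commutator outermost; peeling off the innermost one instead lets
    an induction change the starting subgroup. *)
Lemma iter_commutatorSr c X Y :
  iter_commutator c.+1 X Y = iter_commutator c (commutator_subgroup X Y) Y.
Proof. by rewrite /iter_commutator iterSr. Qed.

Lemma commutatorT_sub X : normal_subgroup X -> commutator_subgroup X setT `<=` X.
Proof.
move=> nX; apply: commutator_min; first by case: nX.
by move=> x y Xx _; exact: normal_subgroupR.
Qed.

End SubgroupTheory.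

Section MorphismSubgroups.
Variables (G H : groupType) (f : {multiplicative G -> H}).

Lemma subgroup_preimage (A : set H) : subgroup A -> subgroup (f @^-1` A).
Proof.
move=> [A1 AB]; split=> [|x y Ax Ay] /=; first by rewrite gmorph1.
by rewrite gmulfM gmorphV; exact: AB.
Qed.

Lemma subgroup_image (A : set G) : subgroup A -> subgroup (f @` A).
Proof.
move=> [A1 AB]; split; first by exists 1; rewrite ?gmorph1.
move=> _ _ [x Ax <-] [y Ay <-]; exists (x * y^-1); first exact: AB.
by rewrite gmulfM gmorphV.
Qed.

Lemma commutator_image (A : set G) (B : set H) c :
  (forall x, A x -> B (f x)) ->
  forall x, iter_commutator c A setT x -> iter_commutator c B setT (f x).
Proof.
move=> AB; elim: c => [|c IH] //=.
pose C := iter_commutator c.+1 B setT.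
apply: (commutator_min (A := f @^-1` C)).
  exact/subgroup_preimage/subgroup_generated_subgroup.
by move=> x y /IH Bx _ /=; rewrite gmorphR; exact: mem_commutator.
Qed.

End MorphismSubgroups.

Section QuotientTheory.
Variables (F : groupType) (K : set F) (nK : normal_subgroup K).
Local Notation pi := (quot_pi nK).

Lemma quot_reprK q : pi (repr q) = q.
Proof. exact: reprK. Qed.

Lemma quot_piM x y : pi (x * y) = pi x * pi y.
Proof. exact: gmulfM. Qed.

Lemma quot_piX n x : pi (x ^+ n) = pi x ^+ n.
Proof. exact: gmorphX. Qed.

Lemma quot_pi1P x : pi x = 1 <-> K x.
Proof.
rewrite -(gmorph1 pi); split=> [/esym|] Kx; last apply/esym; last apply/quot_piP.
  by move/quot_piP: Kx; rewrite invg1 mul1g.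
by rewrite invg1 mul1g.
Qed.

Lemma quot_pi_image (A : set F) x :
  subgroup A -> K `<=` A -> (pi @` A) (pi x) <-> A x.
Proof.
move=> sA KA; split=> [[y Ay /quot_piP /KA]|Ax]; last by exists x.
by move=> /(subgroupM sA Ay); rewrite mulKVg.
Qed.

Lemma quot_lift (H : groupType) (f : {multiplicative F -> H}) :
  (forall x, K x -> f x = 1) ->
  exists g : {multiplicative quot_group nK -> H}, forall x, g (pi x) = f x.
Proof.
move=> fK1; pose g (q : quot_group nK) := f (repr q).
have gE x : g (pi x) = f x.
  have /quot_piP/fK1 : pi x = pi (repr (pi x)) by rewrite quot_reprK.
  by rewrite gmulfM gmorphV => /mulg1_eq; rewrite invgK.
have [h hE] : exists h : {multiplicative quot_group nK -> H}, h =1 g.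
  apply: multiplicative_ex => a b; rewrite -(quot_reprK a) -(quot_reprK b).
  by rewrite -gmulfM !gE gmulfM.
by exists h => x; rewrite hE.
Qed.

End QuotientTheory.

(** * Universal property of the tensor product *)

Section Center.
Variable H : groupType.

(* The centre of [H] as an additive group, to serve as target of [fglift]. *)
Definition central : pred H := fun x => `[< forall y, commute x y >].
Definition center_type : Type := {x : H | central x}.
HB.instance Definition _ := SubChoice.on center_type.
Implicit Types a b : center_type.

Lemma center_valC a (y : H) : commute (val a) y.
Proof. by have /asboolP := valP a. Qed.

Fact center_mul_proof a b : central (val a * val b).
Proof.
by apply/asboolP => y; apply/commute_sym/commuteM; apply/commute_sym/center_valC.
Qed.
Fact center_inv_proof a : central (val a)^-1.
Proof.
by apply/asboolP => y; apply/commute_sym/commuteV/commute_sym/center_valC.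
Qed.
Fact center_one_proof : central 1.
Proof. by apply/asboolP => y; exact/commute_sym/commute1. Qed.

Let cmul a b : center_type := Sub _ (center_mul_proof a b).
Let cinv a : center_type := Sub _ (center_inv_proof a).
Let cone : center_type := Sub _ center_one_proof.

Let cmulA : associative cmul.
Proof. by move=> a b c; apply: val_inj; exact: mulgA. Qed.
Let cmulC : commutative cmul.
Proof. by move=> a b; apply: val_inj; exact: center_valC. Qed.
Let cmul1 : left_id cone cmul.
Proof. by move=> a; apply: val_inj; exact: mul1g. Qed.
Let cmulV : left_inverse cone cinv cmul.
Proof. by move=> a; apply: val_inj; exact: mulVg. Qed.

HB.instance Definition _ :=
  GRing.isZmodule.Build center_type cmulA cmulC cmul1 cmulV.

Lemma center_valD a b : val (a + b)%R = val a * val b.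
Proof. by []. Qed.

End Center.

(** Commuting values put every commutator into the kernel of [f], hence also [x^-1 * y]. *)
Lemma gmorph_abelianization (A H : groupType) (f : {multiplicative A -> H}) x y :
  (forall u v, commute (f u) (f v)) ->
  quot_pi (normal_subgroup_commutator (normal_subgroupT A)) x =
  quot_pi (normal_subgroup_commutator (normal_subgroupT A)) y -> f x = f y.
Proof.
move=> fC /quot_piP; suff : commutator_subgroup [set: A] setT `<=` f @^-1` [set 1].
  move=> sub /sub /=; rewrite gmulfM gmorphV => /mulg1_eq.
  by rewrite invgK.
apply: commutator_min; first by have [] := normal_subgroup_ker f.
by move=> u v _ _ /=; rewrite gmorphR; apply/eqP/commgP/fC.
Qed.

Lemma sub_normal_closure (F : groupType) (X : set F) : X `<=` normal_closure X.
Proof. by move=> x Xx A [_]; exact. Qed.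

Section Tensor.
Variables A B : groupType.

Definition pure_tensor (a : A) (b : B) : tensor A B :=
  quot_pi _ (free_tensor (quot_pi _ a) (quot_pi _ b)).

Lemma pure_tensorMl a a' b :
  pure_tensor (a * a') b = pure_tensor a b * pure_tensor a' b.
Proof.
rewrite -[RHS]gmulfM /pure_tensor [quot_pi _ (a * a')]gmulfM.
apply/quot_piP; apply: sub_normal_closure; left.
by exists (quot_pi _ a), (quot_pi _ a'), (quot_pi _ b).
Qed.

Lemma pure_tensorMr a b b' :
  pure_tensor a (b * b') = pure_tensor a b * pure_tensor a b'.
Proof.
rewrite -[RHS]gmulfM /pure_tensor [quot_pi _ (b * b')]gmulfM.
apply/quot_piP; apply: sub_normal_closure; right.
by exists (quot_pi _ a), (quot_pi _ b), (quot_pi _ b').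
Qed.

(** Every tensor is the class of an integer combination of pairs, by [freeg_sumE], and
    representatives turn each such pair into a pure tensor. *)
Lemma tensor_ind (E : set (tensor A B)) : subgroup E ->
  (forall a b, E (pure_tensor a b)) -> E = setT.
Proof.
move=> sE Ep; apply/seteqP; split=> // q _; rewrite -(quot_reprK q).
move: (repr q) => x.
have sE' := subgroup_preimage (quot_pi (normal_closure_normal
  (@bilinear_relations A B))) sE.
set E' := _ @^-1` _ in sE'; change (E' x).
have E0 : E' (0%R : {freeg _ / int}) by case: sE'.
have ED (u v : {freeg _ / int}) : E' u -> E' v -> E' (u + v)%R.
  exact: (subgroupM sE').
have EN (u : {freeg _ / int}) : E' u -> E' (- u)%R by exact: (subgroupV sE').
rewrite -(freeg_sumE (x : {freeg _ / int})).
apply: (big_ind E') => // -[a b] _; rewrite -[coeff _ _]intz -freegU_mulz.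
have Eab : E' (free_tensor a b).
  by rewrite -(quot_reprK a) -(quot_reprK b); exact: Ep.
have EX n : E' (free_tensor a b *+ n)%R.
  by elim: n => [|n IH]; rewrite ?GRing.mulr0n // GRing.mulrS; exact: ED.
by case: (coeff _ _) => n; [exact: EX|exact/EN/EX].
Qed.

(** The target may be nonabelian, so the map is first built into its centre, where the values of
    [beta] lie and which is a Z-module as [fglift] requires. Bilinearity then kills the defining
    relations. *)
Lemma tensor_lift (H : groupType) (beta : A -> B -> H) :
  (forall a b y, commute (beta a b) y) ->
  (forall a a' b, beta (a * a') b = beta a b * beta a' b) ->
  (forall a b b', beta a (b * b') = beta a b * beta a b') ->
  exists h : {multiplicative tensor A B -> H},
    forall a b, h (pure_tensor a b) = beta a b.
Proof.
move=> betaC betaMl betaMr.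
(* In each argument [beta] is a morphism with commuting values, so it only sees classes in the
   abelianizations. *)
have beta_ab a a' b b' : quot_pi _ a = quot_pi _ a' :> abelianization A ->
    quot_pi _ b = quot_pi _ b' :> abelianization B -> beta a b = beta a' b'.
  move=> aa' bb'; transitivity (beta a' b).
    have [f fE] := multiplicative_ex (fun x y => betaMl x y b).
    by rewrite -!fE; apply: gmorph_abelianization aa' => u v; rewrite !fE.
  have [f fE] := multiplicative_ex (betaMr a').
  by rewrite -!fE; apply: gmorph_abelianization bb' => u v; rewrite !fE.
have betaP (ab : abelianization A * abelianization B) :
    central (beta (repr ab.1) (repr ab.2)).
  by apply/asboolP => y.
pose beta' (ab : abelianization A * abelianization B) : zmodule (center_type H) :=
  (Sub _ (betaP ab) : center_type H).
pose L : {freeg _ / int} -> zmodule (center_type H) := fglift beta'.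
have LB x y : L (x - y)%R = (L x - L y)%R by exact: lift_is_additive.
have L0 : L 0%R = 0%R by rewrite -[0%R in LHS](GRing.subrr 0%R) LB GRing.subrr.
have LN x : L (- x)%R = (- L x)%R.
  by rewrite -[(- x)%R]GRing.sub0r LB L0 GRing.sub0r.
have LD x y : L (x + y)%R = (L x + L y)%R.
  by rewrite -{1}[y]GRing.opprK LB LN GRing.opprK.
pose f0 (x : free_abelian A B) : H := val (L x : center_type H).
have f0M : {morph f0 : x y / x * y}.
  by move=> x y; rewrite /f0 -center_valD -LD.
have [f fE] := multiplicative_ex f0M.
have ft a b : f (free_tensor (quot_pi _ a) (quot_pi _ b)) = beta a b.
  rewrite fE /f0 /L /free_tensor liftU GRing.scale1r.
  by apply: beta_ab; rewrite quot_reprK.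
(* The kernel of [f] is normal and contains the relations, hence contains their normal closure. *)
have [x xE|h hE] := quot_lift (normal_closure_normal (@bilinear_relations A B)) (f := f).
  have : (f @^-1` [set 1]) x; last by [].
  apply: xE; split; first exact: normal_subgroup_ker.
  move=> _ [] [a [b [b' ->]]] /=;
    rewrite -(quot_reprK a) -(quot_reprK b) -(quot_reprK b');
    rewrite -[quot_pi _ _ * quot_pi _ _]gmulfM !(@gmulfM _ _ f) gmorphV !ft.
    by rewrite betaMl mulVg.
  by rewrite betaMr mulVg.
by exists h => a b; rewrite hE ft.
Qed.

End Tensor.

(** * Multilinearity of iterated commutators *)

(* The inductive step is the three subgroup lemma for [F, G_k, R]. *)
Lemma commutator_lower_central (F : groupType) k (R : set F) r x :
  normal_subgroup R -> R r -> iter_commutator k setT setT x ->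
  iter_commutator k.+1 R setT [~ r, x].
Proof.
elim: k R r x => [|k IH] R r x nR Rr Gx; first exact: mem_commutator.
set E := iter_commutator k.+2 R setT.
have nE : normal_subgroup E by exact: normal_subgroup_iter.
have [sE EJ] := nE.
suff /(_ x Gx) : iter_commutator k.+1 setT setT `<=`
    [set z | forall u, R u -> E [~ u, z]] by exact.
apply: commutator_min.
  split=> [u _|y z Ey Ez u Ru]; first by rewrite commg1; case: sE.
  rewrite commgM; apply: (subgroupM sE); last exact: EJ (Ey _ Ru).
  have -> : [~ u, z^-1] = [~ u, z]^-1 ^ z^-1.
    apply/(canRL (conjgK _))/(mulgI [~ u, z]).
    by rewrite -commgM mulVg commg1 mulgV.
  exact: EJ (subgroupV sE (Ez _ Ru)).
move=> y f Gy _ u Ru /=.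
(* The induction hypothesis is used for [[R, F]] here and for [R] in [Ruy]. The Hall-Witt identity
   for [y], [f^-1], [u] then forces its remaining factor, a conjugate of [[~ [~ y, f], u]], into
   [E]. *)
have Ryu : E [~ [~ f^-1, u^-1], y].
  rewrite /E iter_commutatorSr; apply: IH => //; first exact: normal_subgroup_commutator.
  rewrite -invgR; apply: (subgroupV (subgroup_generated_subgroup _)).
  by apply: mem_commutator => //; apply: subgroupV; case: nR.
have sG : subgroup (iter_commutator k [set: F] setT).
  by case: (normal_subgroup_iter k (normal_subgroupT F)).
have Ruy : E [~ [~ u, y^-1], f^-1].
  by apply: mem_commutator => //; apply: IH => //; exact: subgroupV.
have := hall_witt y f^-1 u; rewrite invgK => HW.
have : E [~ [~ y, f], u].
  rewrite -(conjgK f^-1 [~ [~ y, f], u]); apply: (EJ).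
  apply: (@subgroupMr _ E _ (([~ f^-1, u^-1, y] ^ u) * ([~ u, y^-1, f^-1] ^ y))) => //.
    by apply: (subgroupM sE); exact: EJ.
  by rewrite mulgA HW; case: sE.
by move/(subgroupV sE); rewrite invgR.
Qed.

Section CentralSection.
Variables (F : groupType) (R T : set F).
Hypotheses (nR : normal_subgroup R) (nT : normal_subgroup T).
Hypotheses (RT : R `<=` T) (TR : commutator_subgroup T setT `<=` R).

Local Notation pi k := (quot_pi (normal_subgroup_iter k nR)).

Let sV k : subgroup (iter_commutator k T setT).
Proof. by case: (normal_subgroup_iter k nT). Qed.

Lemma iter_commutator_shift k :
  iter_commutator k.+1 T setT `<=` iter_commutator k R setT.
Proof. by rewrite iter_commutatorSr; exact: iter_commutatorS. Qed.

(** A further commutator of [x] falls into [[R, _k F]] by the shift. This centrality is the source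
    of multilinearity. *)
Lemma iter_commutator_central k x :
  iter_commutator k T setT x -> forall y, commute (pi k x) y.
Proof.
move=> Tx y; apply/commgP/eqP; rewrite -(quot_reprK y) -gmorphR.
by apply/quot_pi1P/iter_commutator_shift; exact: mem_commutator.
Qed.

Let pi_commJ k u f g : iter_commutator k T setT u ->
  pi k.+1 ([~ u, f] ^ g) = pi k.+1 [~ u, f].
Proof.
move=> Tu; have /commgP/eqP cR : commute (pi k.+1 [~ u, f]) (pi k.+1 g).
  by apply: iter_commutator_central; exact: mem_commutator.
have -> : [~ u, f] ^ g = [~ u, f] * [~ [~ u, f], g] by rewrite commgEl mulVKg.
by rewrite gmulfM [X in _ * X]gmorphR cR mulg1.
Qed.

Let pi_commMl k u v f : iter_commutator k T setT u ->
  pi k.+1 [~ u * v, f] = pi k.+1 [~ u, f] * pi k.+1 [~ v, f].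
Proof. by move=> Tu; rewrite commMg gmulfM; congr (_ * _); exact: pi_commJ. Qed.

Let pi_commMr k u f g : iter_commutator k T setT u ->
  pi k.+1 [~ u, f * g] = pi k.+1 [~ u, f] * pi k.+1 [~ u, g].
Proof.
move=> Tu; rewrite commgM gmulfM [X in _ * X]pi_commJ //; apply: iter_commutator_central.
exact: mem_commutator.
Qed.

Let pi_comm_eql k u v f : iter_commutator k T setT u ->
  pi k u = pi k v -> pi k.+1 [~ u, f] = pi k.+1 [~ v, f].
Proof.
move=> Tu /quot_piP Ruv; rewrite -[v](mulVKg u) pi_commMl //.
have -> : pi k.+1 [~ u^-1 * v, f] = 1 by apply/quot_pi1P; exact: mem_commutator.
by rewrite mulg1.
Qed.

(* [s] maps [A] onto [T / R], and [r] is a section of a map of [F] onto [Q] with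
   kernel [D]; all that matters is that [D <= F' R]. *)
Variable D : set F.
Hypothesis DR : forall d, D d ->
  exists w z, [/\ commutator_subgroup setT setT w, R z & d = w * z].

(** Write [f^-1 * g] as [w * z]. The factor [w] drops out because the commutator with [u] is a
    morphism with commuting values, so it kills [F']; the factor [z] drops out by
    [commutator_lower_central], as [u] lies in [[F, _k F]]. *)
Let pi_comm_eqr k u f g : iter_commutator k T setT u ->
  D (f^-1 * g) -> pi k.+1 [~ u, f] = pi k.+1 [~ u, g].
Proof.
move=> Tu /DR [w [z [Fw Rz fg]]].
rewrite -[g](mulVKg f) pi_commMr // fg pi_commMr //.
have -> : pi k.+1 [~ u, z] = 1.
  apply/quot_pi1P; rewrite -invgR; apply: (subgroupV (normal_subgroup_iter k.+1 nR).1).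
  by apply: commutator_lower_central => //; apply: iter_commutatorS Tu.
have [phi phiE] := multiplicative_ex (fun x y => pi_commMr x y Tu).
suff /(_ w Fw) : commutator_subgroup [set: F] setT `<=` phi @^-1` [set 1].
  by rewrite /= phiE => ->; rewrite !mulg1.
apply: commutator_min; first by case: (normal_subgroup_ker phi).
move=> x y _ _ /=; rewrite gmorphR !phiE; apply/eqP/commgP.
by apply: (@iter_commutator_central k.+1 [~ u, x]); exact: mem_commutator.
Qed.

Variables (A Q : groupType).
Variable s : {multiplicative A -> quot_group (normal_subgroup_iter 0 nR)}.
Variable r : Q -> F.
Hypothesis s_range : range s = pi 0 @` T.
Hypothesis rM : forall q q', D ((r (q * q'))^-1 * (r q * r q')).
Hypothesis r_surj : forall f, exists q, D ((r q)^-1 * f).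

(** Induction on [c], one factor [Q] at a time: the pair of [a] and [q] goes to the class of
    [[~ repr (h a), r q]]. This is central and bilinear, and its values generate the next
    section. *)
Lemma tensor_power_onto c :
  exists h : {multiplicative tensor_power c A Q ->
                             quot_group (normal_subgroup_iter c nR)},
    range h = pi c @` iter_commutator c T setT.
Proof.
elim: c => [|k [h hE]]; first by exists s.
(* A representative stays in [[T, _k F]], since that subgroup contains [[R, _k F]]. *)
have Vh a : iter_commutator k T setT (repr (h a)).
  apply/(quot_pi_image (normal_subgroup_iter k nR) _ (sV k) (iter_commutatorS RT)).
  by rewrite quot_reprK -hE; exists a.
have [|||h' h'E] := @tensor_lift _ _ _ (fun a q => pi k.+1 [~ repr (h a), r q]).
- by move=> a q y; apply: (@iter_commutator_central k.+1); exact: mem_commutator (Vh a) I.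
- move=> a a' q; rewrite -pi_commMl //; apply: pi_comm_eql => //.
  by rewrite quot_piM !quot_reprK gmulfM.
- by move=> a q q'; rewrite -pi_commMr //; exact: pi_comm_eqr.
exists h'; apply/seteqP; split.
  move=> _ [x _ <-]; set E : set _ := h' @^-1` (pi k.+1 @` iter_commutator k.+1 T setT).
  suff EE : E = setT by change (E x); rewrite EE.
  apply: tensor_ind; first exact/subgroup_preimage/subgroup_image/(sV k.+1).
  move=> a q; rewrite /E /= h'E; exists [~ repr (h a), r q] => //.
  exact: mem_commutator (Vh a) I.
move=> _ [x Vx <-].
suff sub : iter_commutator k.+1 T setT `<=` pi k.+1 @^-1` (range h') by exact: sub.
apply: commutator_min; first by apply/subgroup_preimage/subgroup_image.
move=> u f Tu _ /=.
have [a _ ha] : range h (pi k u) by rewrite hE; exists u.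
have [q Dq] := r_surj f.
exists (pure_tensor a q) => //; rewrite h'E.
transitivity (pi k.+1 [~ repr (h a), f]); first exact: pi_comm_eqr.
by apply: pi_comm_eql => //; rewrite quot_reprK.
Qed.

End CentralSection.

(** * Order, exponent and number of generators *)

Section Least.
Variable P : set nat.

Lemma least_mem n : P n -> P (least P) /\ forall m, P m -> (least P <= m)%N.
Proof.
move=> Pn; have exP : exists k, `[< P k >] by exists n; apply/asboolP.
apply: (@xgetPex _ 0%N [set k | P k /\ forall m, P m -> (k <= m)%N]).
case: (ex_minnP exP) => k /asboolP Pk kmin; exists k; split=> // m Pm.
by apply: kmin; exact/asboolP.
Qed.

(** The default value for an empty set is 0, so a positive value is attained. *)
Lemma least_gt0 : (0 < least P)%N -> P (least P).
Proof.
have [[n Pn] _|nP] := pselect (exists n, P n); first exact: (least_mem Pn).1.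
by rewrite /least xgetPN // => n [Pn _]; apply: nP; exists n.
Qed.

End Least.

Section GroupOrder.

Lemma group_order_infinite (F : groupType) (A : set F) :
  infinite_set A -> group_order A = 0%N.
Proof.
by move=> infA; rewrite /group_order /fset_set; case: pselect => // /infA.
Qed.

Lemma group_order_seq (F : groupType) (s : seq F) :
  uniq s -> group_order [set` s] = size s.
Proof.
move=> us; rewrite /group_order.
have -> : [set` s] = [set` [fset x in s]%fset].
  by apply/seteqP; split=> x /=; rewrite !inE.
by rewrite set_fsetK card_fseq undup_id.
Qed.

Lemma group_order_finset (gT : finGroupType) (A : {set gT}) :
  group_order [set` A] = #|A|.
Proof.
rewrite cardE -group_order_seq ?enum_uniq //; congr group_order.
by apply/seteqP; split=> x /=; rewrite mem_enum.
Qed.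

(* No finiteness is needed: if [M] is infinite then so is its image or its
   intersection with the kernel, and both sides are 0. *)
Lemma group_order_morph (G H : groupType) (f : {multiplicative G -> H}) (M : set G) :
  subgroup M ->
  group_order M = (group_order (f @` M) * group_order (M `&` f @^-1` [set 1%g]))%N.
Proof.
move=> sM; set X := f @` M; set Y := M `&` _.
(* [s] is a set-theoretic section of [f] over [X], with dummy value 1 elsewhere. The products
   [s b * k] then enumerate [M] by pairs from [X] and [Y] without repetition. *)
have /choice[s sP] : forall b, exists a, X b -> M a /\ f a = b.
  move=> b; have [[a Ma <-]|nX] := pselect (X b); first by exists a.
  by exists 1.
have g_inj b b' k k' : X b -> X b' -> Y k -> Y k' ->
    s b * k = s b' * k' -> b = b' /\ k = k'.
  move=> /sP[_ sb] /sP[_ sb'] [_ /= fk] [_ /= fk'] eq_sk.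
  have bb' : b = b'.
    by have := congr1 f eq_sk; rewrite !gmulfM fk fk' sb sb' !mulg1.
  by move: eq_sk; rewrite bb' => /mulgI.
have MXY a : M a -> exists b k, [/\ X b, Y k & a = s b * k].
  move=> Ma; have Xa : X (f a) by exists a.
  have [Ms fs] := sP _ Xa.
  exists (f a), ((s (f a))^-1 * a); rewrite mulVKg; split=> //.
  split; first exact: (subgroupM sM (subgroupV sM Ms)).
  by rewrite /= gmulfM gmorphV fs mulVg.
have XYM b k : X b -> Y k -> M (s b * k).
  by move=> /sP[Ms _] [Mk _]; exact: subgroupM.
have X1 : X 1 by exists 1; [case: sM|rewrite gmorph1].
have Y1 : Y 1 by split; [case: sM|rewrite /= gmorph1].
have [finX|infX] := pselect (finite_set X); last first.
  rewrite [in RHS]group_order_infinite // mul0n group_order_infinite //.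
  by move=> /(finite_image f).
have [finY|infY] := pselect (finite_set Y); last first.
  rewrite [X in (_ * X)%N]group_order_infinite // muln0 group_order_infinite //.
  by apply: contra_not infY; apply: sub_finite_set => k [].
pose S := [seq s b * k | b <- fset_set X, k <- fset_set Y].
have -> : M = [set` S].
  apply/seteqP; split=> a /=.
    move=> /MXY[b [k [Xb Yk ->]]]; apply/allpairsP; exists (b, k).
    by split=> //=; rewrite in_fset_set // inE.
  case/allpairsP => -[b k] /= []; rewrite !in_fset_set // !inE => Xb Yk ->.
  exact: XYM.
rewrite group_order_seq ?size_allpairs //.
apply: allpairs_uniq; [exact: fset_uniq..|].
move=> [b k] [b' k'] /allpairsP[[b1 k1] /= [Xb Yk [-> ->]]].
move=> /allpairsP[[b2 k2] /= [Xb' Yk' [-> ->]]].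
move: Xb Yk Xb' Yk'; rewrite !in_fset_set // !inE => Xb Yk Xb' Yk' eq_sk.
by have [-> ->] := g_inj _ _ _ _ Xb Xb' Yk Yk' eq_sk.
Qed.

Lemma group_order_image_dvd (G H : groupType) (f : {multiplicative G -> H})
    (M : set G) : subgroup M -> (group_order (f @` M) %| group_order M)%N.
Proof. by move=> sM; rewrite (group_order_morph f sM) dvdn_mulr. Qed.

End GroupOrder.

Section Exponent.

(** The remainder of [n] modulo the least exponent also annihilates [A], so by minimality it is
    0. *)
Lemma group_exponent_dvd (F : groupType) (A : set F) n :
  (0 < n)%N -> (forall x, A x -> x ^+ n = 1) -> (group_exponent A %| n)%N.
Proof.
move=> n_gt0 An; set P := [set n | (0 < n)%N /\ forall x, A x -> x ^+ n = 1].
have [[e_gt0 Ae] emin] : P (least P) /\ forall m, P m -> (least P <= m)%N.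
  exact: (@least_mem P n).
change (least P %| n)%N; rewrite /dvdn; apply/negPn/negP; rewrite -lt0n => r_gt0.
have /emin : P (n %% least P)%N.
  split=> // x Ax; have := An x Ax; rewrite {1}(divn_eq n (least P)).
  by rewrite expgnDr mulnC expgnA Ae // expg1n mul1g.
by rewrite leqNgt ltn_pmod.
Qed.

Lemma expg_group_exponent (F : groupType) (A : set F) x :
  (0 < group_exponent A)%N -> A x -> x ^+ group_exponent A = 1.
Proof. by move=> /least_gt0[_]; exact. Qed.

End Exponent.

Section Generators.

(** Unlike a bound on [min_generators], whose value 0 may be a default, this includes finite
    generation; the inequality makes it monotone in [n]. *)
Definition generated_by (F : groupType) n (A : set F) : Prop :=
  exists s : seq F, (size s <= n)%N /\ subgroup_generated [set` s] = A.

Lemma generated_by_min_generators (F : groupType) n (A : set F) :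
  generated_by n A -> generated_by (min_generators A) A.
Proof.
move=> [s [_ sA]].
set P := [set n | exists s : n.-tuple F, subgroup_generated [set` s] = A].
have [] := @least_mem P (size s); first by exists (in_tuple s).
by case=> u uA _; exists u; split=> //; rewrite size_tuple.
Qed.

Lemma min_generators_le (F : groupType) n (A : set F) :
  generated_by n A -> (min_generators A <= n)%N.
Proof.
move=> [s [sn sA]].
set P := [set n | exists s : n.-tuple F, subgroup_generated [set` s] = A].
have [] := @least_mem P (size s); first by exists (in_tuple s).
by move=> _ /(_ (size s)) le; apply: leq_trans (le _) sn; exists (in_tuple s).
Qed.

Lemma generated_byW (F : groupType) m n (A : set F) :
  (m <= n)%N -> generated_by m A -> generated_by n A.
Proof. by move=> mn [s [sm sA]]; exists s; split=> //; exact: leq_trans mn. Qed.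

Lemma subgroup_generated_image (G H : groupType) (f : {multiplicative G -> H})
    (X : set G) : f @` subgroup_generated X = subgroup_generated (f @` X).
Proof.
apply/seteqP; split.
  suff sub : subgroup_generated X `<=` f @^-1` subgroup_generated (f @` X).
    by move=> _ [x Xx <-]; exact: sub.
  apply: subgroup_generated_min.
    exact/subgroup_preimage/subgroup_generated_subgroup.
  by move=> x Xx; apply: sub_subgroup_generated; exists x.
apply: subgroup_generated_min.
  exact/subgroup_image/subgroup_generated_subgroup.
by move=> _ [x Xx <-]; exists x => //; exact: sub_subgroup_generated.
Qed.

Lemma generated_by_image (G H : groupType) (f : {multiplicative G -> H}) n
    (A : set G) : generated_by n A -> generated_by n (f @` A).
Proof.
move=> [s [sn <-]]; exists (map f s); rewrite size_map; split=> //.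
rewrite subgroup_generated_image; congr subgroup_generated.
apply/seteqP; split=> [x /mapP[y sy ->]|_ [y sy <-]]; first by exists y.
exact: map_f.
Qed.

(** Lifts of generators of the image, together with generators of the kernel part, generate [M]. *)
Lemma generated_by_extension (G H : groupType) (f : {multiplicative G -> H}) m n
    (M : set G) : subgroup M -> generated_by m (f @` M) ->
  generated_by n (M `&` f @^-1` [set 1]) -> generated_by (m + n) M.
Proof.
move=> sM [s [sm sE]] [u [un uE]].
have [s' s's Ms'] : exists2 s', map f s' = s & forall x, x \in s' -> M x.
  have : forall y, y \in s -> (f @` M) y.
    by rewrite -sE => y sy; exact: sub_subgroup_generated.
  elim: (s) => [|y r IH] Mr; first by exists [::].
  have [|r' r'E Mr'] := IH; first by move=> z rz; apply: Mr; rewrite inE rz orbT.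
  have [x Mx xy] := Mr y (mem_head _ _).
  exists (x :: r'); first by rewrite /= xy r'E.
  by move=> z; rewrite inE => /predU1P[->//|]; exact: Mr'.
exists (s' ++ u); split; first by rewrite size_cat -(size_map f) s's leq_add.
set C := subgroup_generated _.
have sC : subgroup C by exact: subgroup_generated_subgroup.
have s'C x : x \in s' -> C x.
  by move=> s'x; apply: sub_subgroup_generated; rewrite /= mem_cat s'x.
have uC : subgroup_generated [set` u] `<=` C.
  apply: subgroup_generated_min => // x ux.
  by apply: sub_subgroup_generated; rewrite /= mem_cat [x \in u]ux orbT.
apply/seteqP; split.
  apply: subgroup_generated_min => // x /=; rewrite mem_cat => /orP[/Ms'//|ux].
  by have [] : (M `&` f @^-1` [set 1]) x by rewrite -uE; exact: sub_subgroup_generated.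
move=> x Mx; have : (f @` C) (f x).
  have : (f @` M) (f x) by exists x.
  rewrite -sE; apply: subgroup_generated_min; first exact: subgroup_image.
  by rewrite -s's => _ /mapP[z s'z ->]; exists z => //; exact: s'C.
move=> [y Cy fyx]; rewrite -[x](mulVKg y); apply: (subgroupM sC Cy); apply: uC.
have CM : C `<=` M.
  apply: subgroup_generated_min => // z /=; rewrite mem_cat => /orP[/Ms'//|uz].
  by have [] : (M `&` f @^-1` [set 1]) z by rewrite -uE; exact: sub_subgroup_generated.
rewrite uE; split; first exact: (subgroupM sM (subgroupV sM (CM _ Cy))).
by rewrite /= gmulfM gmorphV fyx mulVg.
Qed.

(** Induction on the generators of [E]. With first generator [a] and [D] generated by the others,
    [A] is generated by [A] meet [D] and one element whose exponent of [a] is minimal positive. *)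
Lemma generated_by_abelian_subgroup (F : groupType) n (E A : set F) :
  (forall x y, E x -> E y -> commute x y) -> generated_by n E ->
  subgroup A -> A `<=` E -> generated_by n A.
Proof.
move=> EC [s [sn sE]] sA AE; apply: generated_byW sn _.
rewrite -{E}sE in EC AE; elim: s A EC sA AE => [|a s IH] A EC sA AE.
  by exists [::]; split=> //; apply/seteqP; split=> //; exact: subgroup_generated_min.
set E := subgroup_generated _ in EC AE.
have sE : subgroup E by exact: subgroup_generated_subgroup.
set D := subgroup_generated [set` s].
have sD : subgroup D by exact: subgroup_generated_subgroup.
have DE : D `<=` E.
  apply: subgroup_generated_min => // x sx; apply: sub_subgroup_generated.
  by rewrite /= inE [x \in s]sx orbT.
have Ea : E a by apply: sub_subgroup_generated; rewrite /= mem_head.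
have EaX j : E (a ^+ j) by exact: (subgroupX _ sE Ea).
have EV x : E x -> E x^-1 by exact: (subgroupV sE).
(* Exponents are natural numbers, so negative powers of [a] are moved to the left-hand side. *)
have Edec : forall x, E x -> exists m k y, D y /\ x * a ^+ m = a ^+ k * y.
  pose B := E `&` [set x | exists m k y, D y /\ x * a ^+ m = a ^+ k * y].
  suff sub : E `<=` B by move=> x /sub[].
  apply: subgroup_generated_min; last first.
    move=> z /=; rewrite inE => /predU1P[->|sz].
      by split=> //; exists 0%N, 1%N, 1; split; [case: sD|rewrite expg0 expg1].
    have Dz : D z by exact: sub_subgroup_generated.
    by split; [exact: DE|exists 0%N, 0%N, z; rewrite expg0 mulg1 mul1g].
  split.
    split; first by case: sE.
    by exists 0%N, 0%N, 1; split=> //; case: sD.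
  move=> x z [Ex [m [k [y [Dy xE]]]]] [Ez [m' [k' [y' [Dy' zE]]]]].
  split; first exact: (subgroupM sE Ex (EV _ Ez)).
  exists (m + k')%N, (k + m')%N, (y * y'^-1); split.
    exact: (subgroupM sD Dy (subgroupV sD Dy')).
  have zV : z^-1 * a ^+ k' = a ^+ m' * y'^-1.
    by apply: (mulgI z); rewrite mulVKg mulgA zE mulgK.
  rewrite addnC expgnDr mulgA -(mulgA x) zV !mulgA.
  rewrite -!mulgA (EC y'^-1 (a ^+ m)) //; last by apply: EV; exact: DE.
  rewrite (mulgA (a ^+ m')) -expgnDr addnC expgnDr -mulgA (mulgA x) xE.
  by rewrite -mulgA (mulgA y) (EC y (a ^+ m')) ?expgnDr ?mulgA //; exact: DE.
(* Replacing an element by its inverse if necessary makes the exponent of [a] nonnegative. *)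
have Adec h : A h -> exists h' j y, [/\ A h', D y, h' = a ^+ j * y & h = h' \/ h = h'^-1].
  move=> Ah; have [m [k [y [Dy hE]]]] := Edec _ (AE _ Ah).
  have Ey := DE _ Dy; have [mk|/ltnW km] := leqP m k.
    exists h, (k - m)%N, y; split=> //; last by left.
    apply: (mulIg (a ^+ m)); rewrite hE -mulgA (EC y) // mulgA -expgnDr subnK //.
  exists h^-1, (m - k)%N, y^-1; split; last by right; rewrite invgK.
  - exact: (subgroupV sA).
  - exact: (subgroupV sD).
  apply: (mulgI h); rewrite mulgV.
  have -> : a ^+ (m - k) * y^-1 = a ^+ m * (a ^+ k * y)^-1.
    rewrite (EC (a ^+ k)) // invgM mulgA -(EC (a ^+ k)^-1 (a ^+ m)) //; last exact: EV.
    by rewrite -{2}(subnKC km) expgnDr mulKg.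
  by rewrite mulgA hE mulgV.
(* The exponents of [a] in elements of [A] modulo [D] are the multiples of the
   least positive one, [k]. *)
pose P := [set k | (0 < k)%N /\ exists h y, [/\ A h, D y & h = a ^+ k * y]].
have IHA : generated_by (size s) (A `&` D).
  apply: IH; first by move=> x y /DE Ex /DE Ey; exact: EC.
    exact: subgroupI.
  by move=> x [].
(* If no positive exponent occurs, [A] lies in [D] and the induction hypothesis suffices. *)
have [[k0 Pk0]|nP] := pselect (exists k, P k); last first.
  suff <- : A `&` D = A by exact: generated_byW IHA.
  apply/seteqP; split=> [x []//|h Ah]; split=> //.
  have [h' [[|j] [y [Ah' Dy h'E hh']]]] := Adec _ Ah; last first.
    by case: nP; exists j.+1; split=> //; exists h', y.
  move: h'E; rewrite expg0 mul1g => h'E.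
  by case: hh' => ->; rewrite h'E //; exact: (subgroupV sD).
have [[k_gt0 [h0 [y0 [Ah0 Dy0 h0E]]]] kmin] := least_mem Pk0.
set k := least P in k_gt0 h0E kmin.
have [u [us uE]] := IHA; exists (h0 :: u); split=> //.
set C := subgroup_generated _; have sC : subgroup C by exact: subgroup_generated_subgroup.
have Ch0 : C h0 by apply: sub_subgroup_generated; rewrite /= mem_head.
have DC x : A x -> D x -> C x.
  move=> Ax Dx; have : (A `&` D) x by [].
  rewrite -uE; apply: subgroup_generated_min => // z uz.
  by apply: sub_subgroup_generated; rewrite /= inE [z \in u]uz orbT.
apply/seteqP; split.
  apply: subgroup_generated_min => // z /=; rewrite inE => /predU1P[->//|uz].
  by have [] : (A `&` D) z by rewrite -uE; exact: sub_subgroup_generated.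
move=> h Ah; have [h' [j [y [Ah' Dy h'E hh']]]] := Adec _ Ah.
suff Ch' : C h' by case: hh' => -> //; exact: (subgroupV sC).
have Ey := DE _ Dy; have Ey0 := DE _ Dy0.
(* Dividing [h'] by [h0 ^+ q] leaves the exponent [r < k], which minimality of [k] forces to be
   0. *)
set q := (j %/ k)%N; set r := (j %% k)%N.
have Ah1 : A (h' * (h0 ^+ q)^-1).
  by apply: (subgroupM sA Ah'); apply: (subgroupV sA); exact: (subgroupX _ sA Ah0).
have Dy1 : D (y * (y0 ^+ q)^-1).
  by apply: (subgroupM sD Dy); apply: (subgroupV sD); exact: (subgroupX _ sD Dy0).
have h1E : h' * (h0 ^+ q)^-1 = a ^+ r * (y * (y0 ^+ q)^-1).
  have h0q : h0 ^+ q = y0 ^+ q * a ^+ (q * k).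
    rewrite h0E expgMn; last exact: EC.
    rewrite -expgnA mulnC; apply: EC => //; exact: (subgroupX _ sE Ey0).
  rewrite h0q invgM h'E (divn_eq j k) addnC expgnDr -/q -/r.
  by rewrite -(mulgA (a ^+ r)) (EC (a ^+ (q * k)) y) // !mulgA mulgK.
have r0 : r = 0%N.
  apply/eqP; rewrite -leqn0 leqNgt; apply/negP => r_gt0.
  have /kmin : P r by split=> //; do 2 eexists; split; [exact: Ah1|exact: Dy1|].
  by rewrite leqNgt ltn_pmod.
rewrite -[h'](mulgVK (h0 ^+ q)); apply: (subgroupM sC); last exact: (subgroupX _ sC Ch0).
by apply: DC => //; rewrite h1E r0 mul1g.
Qed.

End Generators.

Section FiniteGeneration.

Lemma generated_by_finGroup (gT : finGroupType) :
  exists n, generated_by n [set: gT].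
Proof.
exists (size (enum gT)), (enum gT); split=> //; apply/seteqP; split=> // x _.
by apply: sub_subgroup_generated; rewrite /= mem_enum.
Qed.

Lemma generated_by_tensor (A B : groupType) m n :
  generated_by m [set: A] -> generated_by n [set: B] ->
  generated_by (m * n) [set: tensor A B].
Proof.
move=> [s [sm sA]] [u [un uB]].
exists [seq pure_tensor a b | a <- s, b <- u].
rewrite size_allpairs leq_mul //; split=> //; set C := subgroup_generated _.
have sC : subgroup C by exact: subgroup_generated_subgroup.
apply: tensor_ind => // a b.
have CsB a0 b0 : a0 \in s -> C (pure_tensor a0 b0).
  move=> sa0; have [f fE] := multiplicative_ex (pure_tensorMr a0 (B := B)).
  rewrite -fE; have : [set: B] b0 by [].
  rewrite -uB; apply: (subgroup_generated_min (A := f @^-1` C)).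
    exact: subgroup_preimage.
  move=> b1 ub1 /=; rewrite fE; apply: sub_subgroup_generated => /=.
  by apply/allpairsP; exists (a0, b1).
have [f fE] := multiplicative_ex (fun x y => @pure_tensorMl A B x y b).
rewrite -fE; have : [set: A] a by [].
rewrite -sA; apply: (subgroup_generated_min (A := f @^-1` C)).
  exact: subgroup_preimage.
by move=> a0 sa0 /=; rewrite fE; exact: CsB.
Qed.

(** Ensures that [min_generators] of a tensor power is an attained minimum and not the default 0. *)
Lemma generated_by_tensor_power c (A Q : finGroupType) :
  exists n, generated_by n [set: tensor_power c A Q].
Proof.
have [q gQ] := generated_by_finGroup Q.
elim: c => [|c [n gn]]; first exact: generated_by_finGroup.
by exists (n * q)%N; exact: generated_by_tensor.
Qed.

End FiniteGeneration.

(** * Independence of the presentation *)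

Section Presentations.

(** Basis elements are sent to chosen preimages; uniqueness on the basis makes the triangle
    commute. *)
Lemma free_group_lift (F F' H : groupType) (p : {multiplicative F -> H})
    (p' : {multiplicative F' -> H}) : free_group F -> range p `<=` range p' ->
  exists phi : {multiplicative F -> F'}, forall x, p' (phi x) = p x.
Proof.
move=> [X [b freeF]] pp'.
have /choice[g gE] : forall x, exists y, p' y = p (b x).
  by move=> x; have [|y _ <-] := pp' (p (b x)); [exists (b x)|exists y].
have [[phi phiE] _] := freeF F' g; exists phi => x.
have [_ uniq] := freeF H (p \o b).
by apply: (uniq (p' \o phi) p) => y /=; rewrite phiE gE.
Qed.

(** Inductively [alpha y = y * w] with [w] in [[R, _k F]], and [alpha f = f * r] with [r] in [R]. In
    the expansion of [[~ y * w, f * r]] all factors but [[~ y, f]] vanish modulo [[R, _k.+1 F]]: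
    those with [w] by definition, those with [r] by [commutator_lower_central]. *)
Lemma iter_commutator_endo (F : groupType) (R S : set F) c
    (alpha : {multiplicative F -> F}) : normal_subgroup R ->
  (forall x, R (x^-1 * alpha x)) -> forall x, iter_commutator c S setT x ->
  iter_commutator c R setT (x^-1 * alpha x).
Proof.
move=> nR aR; elim: c => [|k IH] x; first by move=> _; exact: aR.
have nW := normal_subgroup_iter k.+1 nR; set W := iter_commutator k.+1 R setT in nW *.
pose pi := quot_pi nW.
have piM u v : pi (u * v) = pi u * pi v by exact: quot_piM.
have piV u : pi u^-1 = (pi u)^-1 by exact: gmorphV.
pose B := [set x | pi x = pi (alpha x)].
suff sub : iter_commutator k.+1 S setT `<=` B by move=> /sub /quot_piP.
apply: commutator_min.
  split=> [|y z By Bz]; first by rewrite /B /= gmorph1.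
  have aE : alpha (y * z^-1) = alpha y * (alpha z)^-1 by rewrite gmulfM gmorphV.
  by rewrite /B /= aE !piM !piV By Bz.
move=> y f Sy _; rewrite /B /= gmorphR -(mulVKg y (alpha y)) -(mulVKg f (alpha f)).
have Rr := aR f; set r := f^-1 * alpha f in Rr *.
have Ww := IH y Sy; set w := y^-1 * alpha y in Ww *.
have W1 u g : iter_commutator k R setT u -> pi [~ u, g] = 1.
  by move=> Wu; apply/quot_pi1P; exact: mem_commutator.
have W1' u g : iter_commutator k R setT u -> pi [~ g, u] = 1.
  move=> Wu; apply/quot_pi1P; rewrite -invgR; apply: (subgroupV nW.1).
  exact: mem_commutator.
have Wr u : iter_commutator k setT setT u -> pi [~ u, r] = 1.
  move=> Gu; apply/quot_pi1P; rewrite -invgR; apply: (subgroupV nW.1).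
  exact: commutator_lower_central.
have conjE (u g : F) : u ^ g = u * [~ u, g] by rewrite commgEl mulVKg.
have Gy : iter_commutator k setT setT y by apply: iter_commutatorS Sy.
have nG j := normal_subgroup_iter j (normal_subgroupT F).
rewrite commMg (piM (_ ^ _)) conjE (piM [~ _, _]) (W1' w) // (W1 w) // !mulg1.
rewrite commgM (piM [~ _, _]) conjE (piM [~ _, _]) (Wr y) // mul1g.
rewrite (Wr [~ y, f]) ?mulg1 //.
exact: normal_subgroupR.
Qed.

(** Lifts [phi] and [psi] exist between the two free groups. The composite [psi \o phi] is the
    identity modulo the kernel of [p1], so by [iter_commutator_endo] it fixes the multiplier and
    [psi] induces a surjection. *)
Lemma multiplier_presentation (gT : finGroupType) (G N : {group gT})
    (F1 F2 : groupType) (p1 : {multiplicative F1 -> gT})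
    (p2 : {multiplicative F2 -> gT}) c :
  free_presentation p1 G -> free_presentation p2 G ->
  exists h : {multiplicative multiplier_ambient c p2 -> multiplier_ambient c p1},
    h @` multiplier c p2 N = multiplier c p1 N.
Proof.
move=> [free1 r1] [free2 r2].
have [|phi phiE] := free_group_lift free1 (p := p1) (p' := p2); first by rewrite r1 r2.
have [|psi psiE] := free_group_lift free2 (p := p2) (p' := p1); first by rewrite r1 r2.
have [|h hE] := quot_lift (normal_subgroup_iter c (normal_subgroup_ker p2))
  (f := quot_pi (normal_subgroup_iter c (normal_subgroup_ker p1)) \o psi).
  move=> x Wx; apply/quot_pi1P; apply: commutator_image Wx.
  by move=> y /=; rewrite psiE.
exists h; apply/seteqP; split.
  move=> _ [_ [x [Rx Sx] <-] <-]; rewrite hE; exists (psi x) => //; split.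
    by rewrite /= psiE.
  by apply: commutator_image Sx => y /=; rewrite psiE.
move=> _ [x [Rx Sx] <-]; exists (quot_pi _ (phi x)).
  exists (phi x) => //; split; first by rewrite /= phiE.
  by apply: commutator_image Sx => y /=; rewrite phiE.
rewrite hE; apply/esym/quot_piP.
apply: (iter_commutator_endo (alpha := psi \o phi)) Sx; first exact: normal_subgroup_ker.
by move=> y /=; rewrite gmulfM gmorphV psiE phiE mulVg.
Qed.

End Presentations.

(** * Filtrations *)

Section QuotientMaps.
Variable F : groupType.

(** Equal subgroups still give distinct quotient types, so properties are carried across by
    substitution, with proof irrelevance identifying the two normality proofs. *)
Lemma quot_transport (P : forall Q : groupType, set Q -> Prop) (K K' A A' : set F)
    (nK : normal_subgroup K) (nK' : normal_subgroup K') :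
  K = K' -> A = A' -> P _ (quot_pi nK @` A) -> P _ (quot_pi nK' @` A').
Proof.
by move=> KK' AA'; subst K' A'; rewrite (Prop_irrelevance nK nK').
Qed.

Lemma quot_map (K L : set F) (nK : normal_subgroup K) (nL : normal_subgroup L) :
  K `<=` L -> exists f : {multiplicative quot_group nK -> quot_group nL},
    forall x, f (quot_pi nK x) = quot_pi nL x.
Proof. by move=> KL; apply: quot_lift => x /KL Lx; exact/quot_pi1P. Qed.

Variable V : nat -> set F.
Hypothesis nV : forall i, normal_subgroup (V i).
Hypothesis V_dec : forall i, V i.+1 `<=` V i.
Local Notation pi i := (quot_pi (nV i)).

Lemma filtration_sub i : V i `<=` V 0.
Proof. by elim: i => // i IH x /V_dec /IH. Qed.

(** Restricted to [V 0], the map from [F / V n.+1] to [F / V n] has kernel [V n / V n.+1], so the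
    orders multiply. *)
Lemma filtration_order (o : nat -> nat) n :
  (forall i, (i < n)%N -> (group_order (pi i.+1 @` V i) %| o i)%N) ->
  (group_order (pi n @` V 0) %| \prod_(0 <= i < n) o i)%N.
Proof.
elim: n => [|n IH] oP.
  rewrite big_geq //; suff -> : pi 0 @` V 0 = [set` [:: 1 : quot_group (nV 0)]].
    by rewrite group_order_seq.
  apply/seteqP; split=> [_ [x Vx <-]|x] /=; rewrite inE.
    by apply/eqP/quot_pi1P.
  by move/eqP->; exists 1; [case: (nV 0) => -[]|rewrite gmorph1].
have [f fE] := quot_map (nV n.+1) (nV n) (@V_dec n).
rewrite (group_order_morph f); last by apply: subgroup_image; case: (nV 0).
have -> : f @` (pi n.+1 @` V 0) = pi n @` V 0.
  apply/seteqP; split=> [_ [_ [x Vx <-] <-]|_ [x Vx <-]].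
    by rewrite fE; exists x.
  by exists (pi n.+1 x); [exists x|exact: fE].
have -> : pi n.+1 @` V 0 `&` f @^-1` [set 1] = pi n.+1 @` V n.
  apply/seteqP; split=> [_ [[x Vx <-]] /=|_ [x Vx <-]].
    by rewrite fE => /quot_pi1P Vnx; exists x.
  split; first by exists x => //; exact: filtration_sub Vx.
  by rewrite /= fE; exact/quot_pi1P.
rewrite big_nat_recr //= dvdn_mul ?oP ?IH // => i /leqW; exact: oP.
Qed.

(** At each level the kernel part of [X] embeds in the abelian section [V n / V n.+1], so it needs
    no more generators than the section does. *)
Lemma filtration_generators (d : nat -> nat) n (X : set F) :
  (forall i, (i < n)%N -> generated_by (d i) (pi i.+1 @` V i)) ->
  (forall i x y, (i < n)%N -> V i x -> V i y -> commute (pi i.+1 x) (pi i.+1 y)) ->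
  subgroup X -> X `<=` V 0 ->
  generated_by (\sum_(0 <= i < n) d i) (pi n @` X).
Proof.
move=> + + sX XV; elim: n => [|n IH] dP VC.
  exists [::]; split=> //; apply/seteqP; split.
    apply: subgroup_generated_min; [exact: subgroup_image|by []].
  move=> _ [x Xx <-]; have /quot_pi1P -> := XV _ Xx.
  by case: (subgroup_generated_subgroup [set` [::] : seq (quot_group (nV 0))]).
have [f fE] := quot_map (nV n.+1) (nV n) (@V_dec n).
rewrite big_nat_recr //=; apply: (generated_by_extension (f := f)).
- exact: subgroup_image.
- have -> : f @` (pi n.+1 @` X) = pi n @` X.
    apply/seteqP; split=> [_ [_ [x Xx <-] <-]|_ [x Xx <-]].
      by rewrite fE; exists x.
    by exists (pi n.+1 x); [exists x|exact: fE].
  by apply: IH => [i /leqW|i x y /leqW]; [exact: dP|exact: VC].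
apply: (generated_by_abelian_subgroup _ (dP n (ltnSn n))).
- by move=> _ _ [x Vx <-] [y Vy <-]; exact: VC.
- apply: subgroupI; first exact: subgroup_image.
  by case: (normal_subgroup_ker f).
by move=> _ [[x Xx <-]] /=; rewrite fE => /quot_pi1P; exists x.
Qed.

Lemma filtration_exponent (e : nat -> nat) n x :
  (forall i x, (i < n)%N -> V i x -> V i.+1 (x ^+ e i)) -> V 0 x ->
  V n (x ^+ (\prod_(0 <= i < n) e i)).
Proof.
elim: n => [|n IH] eP Vx; first by rewrite big_geq.
rewrite big_nat_recr //= expgnA; apply: (eP) => //.
by apply: IH => // i y /leqW; exact: eP.
Qed.

End QuotientMaps.

(** * Pairs of finite groups *)

Section FinitePairs.
Variables (F : groupType) (gT : finGroupType) (p : {multiplicative F -> gT}).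
Variable G : {group gT}.
Hypothesis rp : range p = [set` G].

Let pG f : p f \in G.
Proof. by have : range p (p f) by [exists f]; rewrite rp. Qed.

Lemma subgroup_group (H : {group gT}) : subgroup [set` H].
Proof. by split=> [|x y Hx Hy] /=; rewrite ?group1 ?groupM ?groupV. Qed.

Lemma presentation_preim x : x \in G -> exists f, p f = x.
Proof. by move=> Gx; have : range p x by [rewrite rp]; case=> f _; exists f. Qed.

Lemma normal_subgroup_preim (H : {group gT}) :
  H <| G -> normal_subgroup (p @^-1` [set` H]).
Proof.
move=> /andP[_ nHG]; split; first exact/subgroup_preimage/subgroup_group.
move=> x y /= Hx; rewrite /conjg !gmulfM gmorphV -conjgE memJ_norm //.
exact: (fintype.subsetP nHG _ (pG _)).
Qed.

Lemma commutator_preimage (H K : {group gT}) : [~: H, G] \subset K ->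
  commutator_subgroup (p @^-1` [set` H]) setT `<=` p @^-1` [set` K].
Proof.
move=> HGK; apply: commutator_min; first exact/subgroup_preimage/subgroup_group.
move=> x y /= Hx _; rewrite gmorphR; apply: (fintype.subsetP HGK).
by rewrite mem_commg // pG.
Qed.

Lemma commutator_group_image (A : set F) (H : {group gT}) :
  p @` A = [set` H] -> p @` commutator_subgroup A setT = [set` [~: H, G]].
Proof.
move=> AH; apply/seteqP; split.
  suff sub : commutator_subgroup A setT `<=` p @^-1` [set` [~: H, G]].
    by move=> _ [x Ax <-]; exact: sub.
  apply: commutator_min; first exact/subgroup_preimage/subgroup_group.
  move=> x y Ax _ /=; rewrite gmorphR mem_commg ?pG //.
  by have : [set` H] (p x) by rewrite -AH; exists x.
set D := p @` _.
(* The image is repackaged as a finite group, so that it contains [[~: H, G]] as soon as it contains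
   the generating commutators. *)
pose C : {set gT} := [set x | `[< D x >]]%SET.
have sD : subgroup D.
  exact/subgroup_image/subgroup_generated_subgroup.
have inC x : (x \in C) = `[< D x >] by rewrite finset.in_set.
have gC : group_set C.
  apply/group_setP; split=> [|x y]; rewrite !inC; first by apply/asboolP; case: sD.
  move=> /asboolP Cx /asboolP Cy; apply/asboolP.
  exact: (subgroupM sD).
move=> x /=; suff : [~: H, G] \subset Group gC.
  by move=> /fintype.subsetP sub /sub; rewrite inC => /asboolP.
rewrite gen_subG; apply/fintype.subsetP => _ /imset2P[a b Ha Gb ->].
rewrite inC; apply/asboolP.
have [a' Aa' <-] : (p @` A) a by rewrite AH.
have [b' <-] := presentation_preim Gb.
by rewrite -gmorphR; exists [~ a', b'] => //; exact: mem_commutator.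
Qed.

Lemma iter_commutator_group_image (N : {group gT}) c : N \subset G ->
  p @` iter_commutator c (p @^-1` [set` N]) setT = [set` iter_comm c N G].
Proof.
move=> NG; elim: c => [|c IH]; last exact: commutator_group_image.
apply/seteqP; split=> [_ [x Nx <-]//|x /= Nx].
by have [f fx] := presentation_preim (fintype.subsetP NG _ Nx); exists f; rewrite //= fx.
Qed.

(** [tensor_power_onto] for the preimages of [K] and [L]. The group [Q] enters through maps [e] and
    [j] with a common range, so that it can be [G] or a quotient of [G]; the kernel of [e] serves as
    [D]. *)
Lemma tensor_power_section_onto c (K L : {group gT})
    (nL : normal_subgroup (p @^-1` [set` L])) (X Q : groupType)
    (e : {multiplicative F -> X}) (j : Q -> X) :
  K <| G -> L \subset K -> [~: K, G] \subset L ->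
  {morph j : x y / x * y} -> range j = range e ->
  (forall d, e d = 1 -> exists w z,
     [/\ commutator_subgroup setT setT w, p z \in L & d = w * z]) ->
  exists h : {multiplicative tensor_power c (subg_of K) Q ->
                             quot_group (normal_subgroup_iter c nL)},
    range h = quot_pi _ @` iter_commutator c (p @^-1` [set` K]) setT.
Proof.
move=> nKG LK KGL jM je eD.
have KG : K \subset G by case/andP: nKG.
have LK' : p @^-1` [set` L] `<=` p @^-1` [set` K].
  by move=> x; exact: (fintype.subsetP LK).
have /choice[s sE] : forall a : subg_of K, exists f, p f = sgval a.
  by move=> a; apply: presentation_preim; apply: (fintype.subsetP KG); exact: subgP.
have /choice[r rE] : forall q, exists f, e f = j q.
  by move=> q; have [f _ <-] : range e (j q); [by rewrite -je; exists q|exists f].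
have [s' s'E] : exists s' : {multiplicative subg_of K ->
    quot_group (normal_subgroup_iter 0 nL)}, forall a, s' a = quot_pi _ (s a).
  apply: (multiplicative_ex (f := fun a => quot_pi (normal_subgroup_iter 0 nL) (s a))).
  move=> a b; rewrite -quot_piM; apply/quot_piP => /=.
  by rewrite !gmulfM gmorphV !sE /= mulVg.
refine (@tensor_power_onto F _ _ nL _ _ _ (e @^-1` [set 1]) eD _ _ s' r _ _ _ c).
- exact: normal_subgroup_preim.
- exact: LK'.
- exact: commutator_preimage.
- apply/seteqP; split=> [_ [a _ <-]|_ [x Kx <-]].
    by rewrite s'E; exists (s a) => //=; rewrite sE; exact: subgP.
  exists (subg K (p x)) => //; rewrite s'E; apply/quot_piP => /=.
  by rewrite gmulfM gmorphV sE subgK // mulVg.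
- by move=> q q' /=; rewrite !gmulfM gmorphV !rE jM mulVg.
move=> f; have [q _ qf] : range j (e f) by rewrite je; exists f.
by exists q; rewrite /= gmulfM gmorphV rE qf mulVg.
Qed.

End FinitePairs.

Lemma iter_commutator_sub (F : groupType) (X : set F) c :
  normal_subgroup X -> iter_commutator c X setT `<=` X.
Proof.
move=> nX; elim: c => // c IH x Cx; apply: IH.
exact: commutatorT_sub (normal_subgroup_iter c nX) _ Cx.
Qed.

(** As [c] is positive, the innermost commutator already lies in [Y], and normality keeps the later
    ones there. *)
Lemma iter_commutator_sub1 (F : groupType) (X Y : set F) c :
  (0 < c)%N -> normal_subgroup Y -> commutator_subgroup X setT `<=` Y ->
  iter_commutator c X setT `<=` Y.
Proof.
case: c => // c _ nY XY x; rewrite iter_commutatorSr => /(iter_commutatorS XY).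
exact: iter_commutator_sub.
Qed.

Lemma iter_comm_normal (gT : finGroupType) (G N : {group gT}) i :
  N <| G -> iter_comm i N G <| G.
Proof.
move=> nNG; elim: i => //= i /andP[sG nG].
by rewrite /normal comm_subG //= normsR // normG.
Qed.

Lemma mem_quotient_normal (gT : finGroupType) (H K : {group gT}) x :
  K <| H -> x \in 'N(K) -> coset K x \in H / K -> x \in H.
Proof. by move=> nKH Nx Hx; rewrite -(quotientGK nKH) mem_morphpre. Qed.

(** [coset K] is a morphism only on the normalizer of [K]; precomposed with [p], whose values lie in
    [G], it is one on all of [F]. *)
Lemma multiplicative_coset (F : groupType) (gT : finGroupType)
    (p : {multiplicative F -> gT}) (G K : {group gT}) :
  range p = [set` G] -> K <| G ->
  exists e : {multiplicative F -> coset_of K},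
    [/\ forall x, e x = coset K (p x), range e = [set` (G / K)%g]
      & forall x, e x = 1 <-> p x \in K].
Proof.
move=> rp /andP[_ nKG].
have pG x : p x \in G by have : range p (p x) by [exists x]; rewrite rp.
have pN x : p x \in 'N(K) by exact: (fintype.subsetP nKG _ (pG x)).
have [|e eE] := multiplicative_ex (f := fun x => coset K (p x)).
  by move=> x y; rewrite gmulfM morphM //= pN.
exists e; split=> // [|x]; last first.
  by rewrite eE; split=> [/coset_idr ->//|/coset_id].
apply/seteqP; split=> [_ [x _ <-]|y /= /morphimP[x Nx Gx ->]].
  by rewrite /= eE mem_quotient.
have [f _ <-] : range p x by rewrite rp.
by exists f => //; rewrite eE.
Qed.

Lemma range_sgval (gT : finGroupType) (H : {group gT}) :
  range (fun x : subg_of H => sgval x) = [set` H].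
Proof.
apply/seteqP; split=> [_ [x _ <-]|x Hx]; first exact: subgP.
by exists (subg H x) => //; rewrite subgK.
Qed.

(** For central [N] the multiplier is a quotient of a tensor power of finite groups. It serves to
    make [min_generators] of the multiplier of the quotient pair an attained minimum. *)
Lemma multiplier_generated (c : nat) (gT : finGroupType) (G N : {group gT})
    (F : groupType) (p : {multiplicative F -> gT}) :
  (0 < c)%N -> N <| G -> [~: N, G] = 1 -> range p = [set` G] ->
  exists n, generated_by n (multiplier c p N).
Proof.
move=> c_gt0 nNG NG1 rp.
have nL : normal_subgroup (p @^-1` [set` (1%G : {group gT})]).
  by apply: (normal_subgroup_preim rp); exact: normal1.
have kerE : p @^-1` [set` (1%G : {group gT})] = p @^-1` [set 1].
  by apply/seteqP; split=> x /=; rewrite finset.in_set1 => /eqP.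
have [||||||h hE] := @tensor_power_section_onto F gT p G rp c N 1%G nL gT
    (subg_of G) p (fun x => sgval x).
- exact: nNG.
- exact: sub1G.
- by rewrite NG1.
- by move=> x y.
- by rewrite range_sgval.
- move=> d d1; exists 1, d; split; rewrite ?mul1g ?d1 ?group1 //.
  exact: (subgroup_generated_subgroup _).1.
have [n gn] := generated_by_tensor_power c (subg_of N) (subg_of G).
exists n; have := generated_by_image h gn; rewrite hE.
apply: (quot_transport (P := fun _ A => generated_by n A)).
  by rewrite kerE.
apply/seteqP; split=> [x Sx|x []//]; split=> //.
(* Centrality and [c > 0] put [[S, _c F]] inside the kernel [R], so the intersection defining the
   multiplier is all of [[S, _c F]]. *)
have sub : commutator_subgroup (p @^-1` [set` N]) setT `<=` p @^-1` [set` 1%G].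
  by apply: (commutator_preimage rp); rewrite NG1.
move: Sx; rewrite -kerE.
exact: (iter_commutator_sub1 c_gt0 nL sub).
Qed.

Theorem theorem3p6 (c t : nat) (hc : (1 <= c)%N) (ht : (2 <= t)%N)
    (gT : finGroupType) (G N : {group gT}) (hN : N <| G)
    (hnil : iter_comm t N G :=: 1)
    (F : groupType) (p : {multiplicative F -> gT})
    (hp : free_presentation p G)
    (F' : groupType) (p' : {multiplicative F' -> coset_of [~: N, G]})
    (hp' : free_presentation p' (G / [~: N, G])%G) :
  let M := multiplier c p N in
  let M' := multiplier c p' (N / [~: N, G])%G in
  let T i : groupType :=
    tensor_power c (subg_of (iter_comm i N G)) (subg_of (G / iter_comm i N G)%G) in
  [/\ (#|iter_comm c N G| * group_order M %|
         group_order M' * \prod_(1 <= i < t) group_order [set: T i]%classic)%N,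
      (min_generators M <=
         min_generators M' + \sum_(1 <= i < t) min_generators [set: T i]%classic)%N
    & (group_exponent M %|
         group_exponent M' * \prod_(1 <= i < t) group_exponent [set: T i]%classic)%N].
Proof.
move=> M M' T; have [freeF rp] := hp.
have pG x : p x \in G by have : range p (p x) by [exists x]; rewrite rp.
pose K i := iter_comm i N G.
have nK i : K i <| G by exact: iter_comm_normal.
have KG i : [~: K i, G] \subset K i by rewrite commg_subl; case/andP: (nK i).
have nK1N : K 1%N <| N.
  by apply: normalS (KG 0%N) (normal_sub hN) (nK 1%N).
have nN' : (N / [~: N, G])%G <| (G / [~: N, G])%G by exact: quotient_normal.
have N'G1 : [~: (N / [~: N, G])%G, (G / [~: N, G])%G] = 1.
  rewrite -quotientR ?trivg_quotient //; last exact: normal_norm (nK 1%N).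
  exact: normal_norm nK1N.
have nT i := normal_subgroup_preim rp (nK i).
set S := fun i => p @^-1` [set` K i] in nT.
have S_dec i : S i.+1 `<=` S i by move=> x; exact: (fintype.subsetP (KG i)).
have SR i : commutator_subgroup (S i) setT `<=` S i.+1.
  by apply: (commutator_preimage rp); exact: subxx.
pose V i := iter_commutator c (S i) setT.
pose nV i : normal_subgroup (V i) := normal_subgroup_iter c (nT i).
have V_dec i : V i.+1 `<=` V i by exact: iter_commutatorS.
have kerE : S t = p @^-1` [set 1].
  by apply/seteqP; split=> x; rewrite /S /= /K hnil finset.in_set1 => /eqP.
pose X := p @^-1` [set 1] `&` V 0%N.
(* [M] lives in the quotient by [[R, _c F]], which is only propositionally equal
   to [V t]. *)
have MX (P : forall Q : groupType, set Q -> Prop) :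
    P _ (quot_pi (nV t) @` X) -> P _ M.
  by apply: quot_transport; rewrite // /V kerE.
have sX : subgroup X.
  by apply: subgroupI; [case: (normal_subgroup_ker p)|case: (nV 0%N)].
have V1 : V 0%N `<=` S 1%N.
  exact: (iter_commutator_sub1 hc (nT 1%N) (SR 0%N)).
(* Composing [p] with the quotient map presents [G / [N, G]] freely by the same [F], with kernel
   [S 1]. Since [V 0] lies in [S 1], the multiplier of this presentation is exactly [V 0 / V 1], and
   [M'] maps onto it. *)
have [e1 [e1E re1 ker1]] := multiplicative_coset rp (nK 1%N).
have [h0 h0E] : exists h : {multiplicative multiplier_ambient c p' ->
    quot_group (nV 1%N)}, h @` M' = quot_pi (nV 1%N) @` V 0%N.
  have fe1 : free_presentation (e1 : {multiplicative F -> coset_of [~: N, G]})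
    (G / [~: N, G])%G by [].
  have := multiplier_presentation (N / [~: N, G])%G c fe1 hp'.
  apply: (quot_transport (P := fun Q A =>
    exists h : {multiplicative multiplier_ambient c p' -> Q}, h @` M' = A)).
    congr iter_commutator; apply/seteqP; split=> x /=; by rewrite ker1.
  have -> : e1 @^-1` [set` (N / [~: N, G])%G] = S 0%N.
    apply/seteqP; split=> x; rewrite /S /= e1E; last exact: mem_quotient.
    apply: mem_quotient_normal nK1N _.
    exact: (fintype.subsetP (normal_norm (nK 1%N)) _ (pG x)).
  apply/seteqP; split=> [x []//|x Vx]; split=> //=; apply/ker1.
  exact: V1.
have sM' : subgroup M'.
  apply/subgroup_image/subgroupI; first by case: (normal_subgroup_ker p').
  by case: (normal_subgroup_iter c (normal_subgroup_preim hp'.2 nN')).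
have [n0 gM'] : exists n, generated_by n M'.
  exact: multiplier_generated hc nN' N'G1 hp'.2.
have sec i : (0 < i)%N -> exists h : {multiplicative T i -> quot_group (nV i.+1)},
    range h = quot_pi (nV i.+1) @` V i.
  case: i => // i _; have [e [eE re ker]] := multiplicative_coset rp (nK i.+1).
  refine (@tensor_power_section_onto F gT p G rp c (K i.+1) (K i.+2) (nT i.+2) _ _
    e (fun x => sgval x) _ _ _ _ _ _).
  - exact: nK.
  - exact: (KG i.+1).
  - exact: subxx.
  - by move=> x y.
  - by rewrite range_sgval re.
  (* Here [p d] lies in [K i.+1], which is the image of [[S i, F]]; hence [d] is an element [w] of
     [F'] times an element of the kernel of [p]. Positivity of the section index supplies the
     predecessor [K i]. *)
  move=> d /ker Kd.
  have : (p @` commutator_subgroup (S i) setT) (p d).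
    rewrite (commutator_group_image rp (H := K i)) //.
    exact: (iter_commutator_group_image rp 0 (normal_sub (nK i))).
  move=> [w Sw wd]; exists w, (w^-1 * d); split; last by rewrite mulVKg.
    by apply: commutatorSl Sw.
  by rewrite gmulfM gmorphV wd mulVg group1.
(* Index 0 stands for the section [V 0 / V 1], bounded by [M'], so each right-hand side becomes one
   product or sum over [0 <= i < t]. *)
pose o i := if i is 0 then group_order M' else group_order [set: T i].
pose d i := if i is 0 then min_generators M' else min_generators [set: T i].
pose e i := if i is 0 then group_exponent M' else group_exponent [set: T i].
have t_gt0 : (0 < t)%N by exact: leq_trans ht.
have V0t : V t `<=` p @^-1` [set 1] by rewrite -kerE; exact: (iter_commutator_sub (nT t)).
split.
- have -> : (group_order M' * \prod_(1 <= i < t) group_order [set: T i] =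
      \prod_(0 <= i < t) o i)%N.
    by rewrite [RHS]big_ltn //; congr muln; apply: eq_big_nat => -[].
  (* The map induced by [p] on [V 0 / V t] has image [[N, _c G]] and kernel [M]. *)
  have -> : (#|iter_comm c N G| * group_order M =
      group_order (quot_pi (nV t) @` V 0%N))%N.
    have [pt ptE] := quot_lift (nV t) (f := p) V0t.
    rewrite (group_order_morph pt); last by apply: subgroup_image; case: (nV 0%N).
    have -> : pt @` (quot_pi (nV t) @` V 0%N) = [set` iter_comm c N G].
      rewrite -(iter_commutator_group_image rp) ?normal_sub //.
      apply/seteqP; split=> [_ [_ [x Vx <-] <-]|_ [x Vx <-]].
        by rewrite ptE; exists x.
      by exists (quot_pi (nV t) x); [exists x|rewrite ptE].
    rewrite group_order_finset; congr muln.
    apply: (MX (fun _ A => group_order A = _)); congr group_order.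
    apply/seteqP; split=> [_ [x [px Vx] <-]|_ [[x Vx <-] /=]].
      by split; [exists x|rewrite /= ptE].
    by rewrite ptE => px; exists x.
  apply: filtration_order => // -[|i] it; rewrite /o.
    by rewrite -h0E; exact: group_order_image_dvd.
  have [h hE] := sec i.+1 isT; rewrite -hE; exact: group_order_image_dvd.
- have -> : (min_generators M' + \sum_(1 <= i < t) min_generators [set: T i] =
      \sum_(0 <= i < t) d i)%N.
    by rewrite [RHS]big_ltn //; congr addn; apply: eq_big_nat => -[].
  apply: (MX (fun _ A => (min_generators A <= _)%N)).
  apply/min_generators_le/filtration_generators => //.
  + move=> [|i] it; rewrite /d.
      rewrite -h0E; apply: generated_by_image; exact: generated_by_min_generators gM'.
    have [h hE] := sec i.+1 isT; rewrite -hE; apply: generated_by_image.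
    have [n gn] := generated_by_tensor_power c (subg_of (K i.+1))
      (subg_of (G / K i.+1)%G).
    exact: generated_by_min_generators gn.
  + move=> i x y it Vx Vy.
    exact: (@iter_commutator_central F _ _ (nT i.+1) (SR i) c x Vx).
  by move=> x [].
have -> : (group_exponent M' * \prod_(1 <= i < t) group_exponent [set: T i] =
    \prod_(0 <= i < t) e i)%N.
  by rewrite [RHS]big_ltn //; congr muln; apply: eq_big_nat => -[].
(* A zero product makes the divisibility trivial; otherwise every [e i] is positive, hence a true
   exponent and not the default 0. *)
have [->|e_gt0] := posnP (\prod_(0 <= i < t) e i); first exact: dvdn0.
apply: (MX (fun _ A => (group_exponent A %| _)%N)).
apply: group_exponent_dvd => // _ [x [_ Vx] <-].
rewrite -quot_piX; apply/quot_pi1P; apply: filtration_exponent => // i y it Vy.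
have ei_gt0 : (0 < e i)%N.
  move: e_gt0; rewrite (bigD1_seq i) ?iota_uniq ?mem_index_iota //=.
  by rewrite muln_gt0 => /andP[].
apply/quot_pi1P; rewrite quot_piX.
case: i ei_gt0 it Vy => [|i] ei_gt0 it Vy.
  have [a Ma <-] : (h0 @` M') (quot_pi (nV 1%N) y) by rewrite h0E; exists y.
  by rewrite -gmorphX expg_group_exponent // gmorph1.
have [h hE] := sec i.+1 isT.
have [a _ <-] : range h (quot_pi (nV i.+2) y) by rewrite hE; exists y.
by rewrite -gmorphX expg_group_exponent // gmorph1.
Qed.
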